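(* Suppose $\langle f_\alpha : \alpha < \omega_1\rangle$ is a bowtie of functions, where $f_\alpha$ is a permutation of $D_\alpha \subseteq \omega$ for each $\alpha<\omega_1$. Then there is a nontrivial automorphism $F$ of $\mathcal P(\omega)/\mathrm{Fin}$. Furthermore, there is a closed $P$-set in $\omega^*$ with character $\aleph_1$, namely $K = \bigcap_{\alpha < \omega_1} (\omega \setminus D_\alpha)^*$, such that $F$ is trivial on $A$ whenever $A \subseteq \omega$ and $A^*$ does not meet the boundary of $K$ in $\omega^*$. Moreover, if the bowtie of functions $\langle f_\alpha : \alpha<\omega_1\rangle$ is a bowtie of involutions, then $F$ is an involution of $\mathcal P(\omega)/\mathrm{Fin}$ (i.e. $F^2=\mathrm{id}$).
   Context: $\mathcal P(\omega)/\mathrm{Fin}$ is the quotient of the Boolean algebra $\mathcal P(\omega)$ by the ideal of finite sets; $[A]_{\mathrm{Fin}}$ is the class of $A$. For $A,B \subseteq \omega$, $A =^* B$ means that the symmetric difference is finite, and $A \subseteq^* B$ means $A \setminus B$ is finite. For functions, $f =^* g$ means $\mathrm{dom}(f) =^* \mathrm{dom}(g) =^* \{x \in \mathrm{dom}(f)\cap \mathrm{dom}(g) : f(x) = g(x)\}$. $\omega^* = \beta\omega\setminus\omega$ is the Stone space of $\mathcal P(\omega)/\mathrm{Fin}$ (the space of nonprincipal ultrafilters on $\omega$), and for $A \subseteq \omega$, $A^* = \{u \in \omega^* : A \in u\}$. A closed set $K \subseteq \omega^*$ is a $P$-set if the intersection of any countably many neighborhoods of $K$ is a neighborhood of $K$;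 its character is the least cardinality of a neighborhood base of $K$ in $\omega^*$. An almost permutation of $\omega$ is a bijection between cofinite subsets of $\omega$. An automorphism of $\mathcal P(\omega)/\mathrm{Fin}$ is trivial if it has the form $[A]_{\mathrm{Fin}} \mapsto [f[A]]_{\mathrm{Fin}}$ for some almost permutation $f$ of $\omega$. Similarly, an isomorphism $\mathcal P(A)/\mathrm{Fin} \to \mathcal P(B)/\mathrm{Fin}$ is trivial if it is induced in this way by an almost bijection $A \to B$ (a bijection between a cofinite subset of $A$ and a cofinite subset of $B$). An automorphism $F$ of $\mathcal P(\omega)/\mathrm{Fin}$ is trivial on $A \subseteq \omega$ if its restriction to $\mathcal P(A)/\mathrm{Fin}$, an isomorphism onto $\mathcal P(B)/\mathrm{Fin}$ where $[B]_{\mathrm{Fin}} = F([A]_{\mathrm{Fin}})$, is trivial in this sense. Bowtie of functions: for each $\alpha<\omega_1$ let $D_\alpha \subseteq \omega$ and let $f_\alpha$ be a permutation $D_\alpha \to D_\alpha$ with no fixed points. The sequence $\langle f_\alpha : \alpha<\omega_1\rangle$ is a bowtie of functions if (i) $D_\alpha \subseteq^* D_\beta$ and $D_\beta \setminus D_\alpha$ is infinite whenever $\alpha<\beta<\omega_1$; (ii) $f_\alpha =^* f_\beta \restriction D_\alpha$ whenever $\alpha \le \beta<\omega_1$; (iii) for every $A \subseteq \omega$ there is some $\delta_A<\omega_1$ such that if $\delta_A \le \alpha<\omega_1$ then $f_\alpha[(D_\alpha \setminus D_{\delta_A}) \cap A] =^* (D_\alpha\setminus D_{\delta_A}) \cap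 A$ and $f_\alpha[(D_\alpha\setminus D_{\delta_A})\setminus A] =^* (D_\alpha\setminus D_{\delta_A})\setminus A$. It is a bowtie of involutions if furthermore each $f_\alpha$ satisfies $f_\alpha^2 = \mathrm{id}$. *)

(* Defs.v *)
From HB Require Import structures.
From mathcomp Require Import all_boot all_order.
From mathcomp Require Import generic_quotient.
From mathcomp Require Import all_classical topology.
From mathcomp Require wochoice.

Set Implicit Arguments.
Unset Strict Implicit.
Unset Printing Implicit Defensive.
Import Order.TTheory.
Local Open Scope classical_set_scope.
Local Open Scope card_scope.

(** [=^*] and [\subseteq^*] on subsets of omega *)

Definition almost_sub (A B : set nat) : Prop := finite_set (A `\` B).
Definition almost_eq (A B : set nat) : Prop := finite_set (A `+` B).

Lemma almost_eqP (A B : set nat) :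
  almost_eq A B <-> almost_sub A B /\ almost_sub B A.
Proof. by rewrite /almost_eq /setY finite_setU. Qed.

Lemma almost_sub_trans (A B C : set nat) :
  almost_sub A B -> almost_sub B C -> almost_sub A C.
Proof.
move=> AB BC; apply: (@sub_finite_set _ _ ((A `\` B) `|` (B `\` C))).
  by move=> x [Ax nCx]; case: (pselect (B x)) => Bx; [right|left].
by rewrite finite_setU.
Qed.

Lemma almost_eq_refl (A : set nat) : almost_eq A A.
Proof. by rewrite /almost_eq setYK. Qed.

Lemma almost_eq_sym (A B : set nat) : almost_eq A B -> almost_eq B A.
Proof. by rewrite /almost_eq setYC. Qed.

Lemma almost_eq_trans (A B C : set nat) :
  almost_eq A B -> almost_eq B C -> almost_eq A C.
Proof.
move=> /almost_eqP[AB BA] /almost_eqP[BC CB]; apply/almost_eqP.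
by split; [exact: almost_sub_trans AB BC|exact: almost_sub_trans CB BA].
Qed.

Lemma almost_eqI (A B C D : set nat) :
  almost_eq A B -> almost_eq C D -> almost_eq (A `&` C) (B `&` D).
Proof.
move=> AB CD; apply: (@sub_finite_set _ _ ((A `+` B) `|` (C `+` D))).
  move=> x; rewrite /setY /setD /setI /setU /=.
  by case: (pselect (A x)) (pselect (B x)) (pselect (C x)) (pselect (D x)); tauto.
by rewrite finite_setU.
Qed.

Lemma almost_eqC (A B : set nat) :
  almost_eq A B -> almost_eq (~` A) (~` B).
Proof.
apply: sub_finite_set => x; rewrite /setY /setD /setC /setU /=.
by case: (pselect (A x)) (pselect (B x)); tauto.
Qed.

Lemma almost_eqU (A B C D : set nat) :
  almost_eq A B -> almost_eq C D -> almost_eq (A `|` C) (B `|` D).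
Proof.
move=> AB CD; apply: (@sub_finite_set _ _ ((A `+` B) `|` (C `+` D))).
  move=> x; rewrite /setY /setD /setI /setU /=.
  by case: (pselect (A x)) (pselect (B x)) (pselect (C x)) (pselect (D x)); tauto.
by rewrite finite_setU.
Qed.

(** The Boolean algebra P(omega)/Fin *)

Definition almost_eqb (A B : set nat) : bool := `[< almost_eq A B >].

Lemma almost_eqb_equiv : equiv_class_of almost_eqb.
Proof.
split=> [A|A B|B A C].
- exact/asboolP/almost_eq_refl.
- by apply/asboolP/asboolP => /almost_eq_sym.
- by move=> /asboolP AB /asboolP BC; apply/asboolP/(almost_eq_trans AB BC).
Qed.

Canonical almost_eqb_equiv_rel := EquivRelPack almost_eqb_equiv.

Definition pow_fin := {eq_quot almost_eqb}%qT.
HB.instance Definition _ := Choice.on pow_fin.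
HB.instance Definition _ := EqQuotient.on pow_fin.

Definition fin_class (A : set nat) : pow_fin := (\pi_pow_fin A)%qT.

Lemma fin_classP (A B : set nat) :
  fin_class A = fin_class B <-> almost_eq A B.
Proof.
by split => [/eqquotP/asboolP//|AB]; apply/eqquotP/asboolP.
Qed.

Lemma fin_class_repr (x : pow_fin) : fin_class (repr x) = x.
Proof. exact: reprK. Qed.

Lemma fin_class_ind (P : pow_fin -> Prop) :
  (forall A, P (fin_class A)) -> forall x, P x.
Proof. by move=> PA x; rewrite -(fin_class_repr x). Qed.

Lemma almost_eq_repr (A : set nat) : almost_eq (repr (fin_class A)) A.
Proof. by apply/fin_classP; rewrite fin_class_repr. Qed.

Module PowFinOrder.

Definition meet (x y : pow_fin) := fin_class (repr x `&` repr y).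
Definition join (x y : pow_fin) := fin_class (repr x `|` repr y).
Definition compl (x : pow_fin) := fin_class (~` repr x).
Definition le (x y : pow_fin) := meet x y == x.
Definition lt (x y : pow_fin) := (y != x) && le x y.

Lemma meetE A B : meet (fin_class A) (fin_class B) = fin_class (A `&` B).
Proof. by apply/fin_classP/almost_eqI; exact: almost_eq_repr. Qed.

Lemma joinE A B : join (fin_class A) (fin_class B) = fin_class (A `|` B).
Proof. by apply/fin_classP/almost_eqU; exact: almost_eq_repr. Qed.

Lemma complE A : compl (fin_class A) = fin_class (~` A).
Proof. by apply/fin_classP/almost_eqC; exact: almost_eq_repr. Qed.

Lemma meetC : commutative meet.
Proof. by move=> x y; rewrite /meet setIC. Qed.

Lemma joinC : commutative join.
Proof. by move=> x y; rewrite /join setUC. Qed.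

Lemma meetA : associative meet.
Proof.
elim/fin_class_ind=> A; elim/fin_class_ind=> B; elim/fin_class_ind=> C.
by rewrite !meetE setIA.
Qed.

Lemma joinA : associative join.
Proof.
elim/fin_class_ind=> A; elim/fin_class_ind=> B; elim/fin_class_ind=> C.
by rewrite !joinE setUA.
Qed.

Lemma joinKI y x : meet x (join x y) = x.
Proof.
elim/fin_class_ind: x => A; elim/fin_class_ind: y => B.
by rewrite joinE meetE setUC setKU.
Qed.

Lemma meetKU y x : join x (meet x y) = x.
Proof.
elim/fin_class_ind: x => A; elim/fin_class_ind: y => B.
by rewrite meetE joinE setIC setKI.
Qed.

Lemma meetUl : left_distributive meet join.
Proof.
elim/fin_class_ind=> A; elim/fin_class_ind=> B; elim/fin_class_ind=> C.
by rewrite joinE !meetE joinE setIUl.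
Qed.

Lemma meetxx : idempotent_op meet.
Proof. by elim/fin_class_ind=> A; rewrite meetE setIid. Qed.

Lemma le0x x : le (fin_class set0) x.
Proof. by elim/fin_class_ind: x => A; rewrite /le meetE set0I. Qed.

Lemma lex1 x : le x (fin_class setT).
Proof. by elim/fin_class_ind: x => A; rewrite /le meetE setIT. Qed.

Lemma joinxC x : join x (compl x) = fin_class setT.
Proof. by elim/fin_class_ind: x => A; rewrite complE joinE setUv. Qed.

Lemma meetxC x : meet x (compl x) = fin_class set0.
Proof. by elim/fin_class_ind: x => A; rewrite complE meetE setICr. Qed.

End PowFinOrder.

Fact pow_fin_display : Order.disp_t. Proof. by []. Qed.

HB.instance Definition _ :=
  Order.isMeetJoinDistrLattice.Build pow_fin_display pow_fin
    (fun _ _ => erefl) (fun _ _ => erefl)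
    PowFinOrder.meetC PowFinOrder.joinC PowFinOrder.meetA PowFinOrder.joinA
    PowFinOrder.joinKI PowFinOrder.meetKU PowFinOrder.meetUl PowFinOrder.meetxx.
HB.instance Definition _ :=
  Order.hasBottom.Build pow_fin_display pow_fin PowFinOrder.le0x.
HB.instance Definition _ :=
  Order.hasTop.Build pow_fin_display pow_fin PowFinOrder.lex1.
HB.instance Definition _ :=
  Order.TBDistrLattice_hasComplement.Build pow_fin_display pow_fin
    PowFinOrder.joinxC PowFinOrder.meetxC.

Lemma fin_classI A B :
  fin_class (A `&` B) = (fin_class A `&` fin_class B)%O.
Proof. by rewrite -PowFinOrder.meetE. Qed.

Lemma fin_classU A B :
  fin_class (A `|` B) = (fin_class A `|` fin_class B)%O.
Proof. by rewrite -PowFinOrder.joinE. Qed.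

Lemma fin_classC A : fin_class (~` A) = (~` (fin_class A))%O.
Proof. by rewrite -PowFinOrder.complE. Qed.

Lemma fin_class_le A B : (fin_class A <= fin_class B)%O <-> almost_sub A B.
Proof.
have -> : almost_sub A B <-> almost_eq (A `&` B) A.
  rewrite almost_eqP /almost_sub setDIr setDv set0U.
  have -> : (A `&` B) `\` A = set0.
    by apply/seteqP; split=> x //= [[]].
  by split=> [|[]].
rewrite -fin_classP fin_classI leEmeet; split=> [/eqP //|->]; exact: eqxx.
Qed.

Definition automorphism (F : pow_fin -> pow_fin) : Prop :=
  [/\ bijective F,
      {morph F : x y / (x `&` y)%O},
      {morph F : x y / (x `|` y)%O} &
      {morph F : x / (~` x)%O}].

(** Partial functions on omega; the values of [pfun_val f] outside [pdom f]
    are irrelevant. *)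

Record pfun := PFun { pdom : set nat; pfun_val :> nat -> nat }.

Definition pimage (f : pfun) (A : set nat) : set nat := f @` (A `&` pdom f).

Definition prestrict (f : pfun) (A : set nat) : pfun := PFun (pdom f `&` A) f.

Definition pfun_almost_eq (f g : pfun) : Prop :=
  almost_eq (pdom f) (pdom g) /\
  almost_eq (pdom g) [set x | [/\ pdom f x, pdom g x & f x = g x]].

Definition almost_bijection (A B : set nat) (f : pfun) : Prop :=
  exists2 B', set_bij (pdom f) B' f &
    [/\ pdom f `<=` A, finite_set (A `\` pdom f),
        B' `<=` B & finite_set (B `\` B')].

Definition almost_permutation (f : pfun) : Prop := almost_bijection setT setT f.

Definition trivial_automorphism (F : pow_fin -> pow_fin) : Prop :=
  exists2 f, almost_permutation f &
    forall A, F (fin_class A) = fin_class (pimage f A).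

(** P(A)/Fin is identified with the set of classes of subsets of [A]. *)
Definition trivial_on (F : pow_fin -> pow_fin) (A : set nat) : Prop :=
  exists B, F (fin_class A) = fin_class B /\
    exists2 f, almost_bijection A B f &
      forall X, X `<=` A -> F (fin_class X) = fin_class (pimage f X).

(** The space of nonprincipal ultrafilters on omega *)

Record omega_star := OmegaStar {
  ultra_of :> set_system nat;
  omega_star_ultra : UltraFilter ultra_of;
  omega_star_nonprincipal : forall n, ultra_of <> principal_filter n }.

HB.instance Definition _ := gen_eqMixin omega_star.
HB.instance Definition _ := gen_choiceMixin omega_star.

Definition star (A : set nat) : set omega_star := [set u | ultra_of u A].

Lemma star_cover : \bigcup_(A in [set: set nat]) star A = setT.
Proof.
apply/seteqP; split=> // u _; exists setT => //.
have := omega_star_ultra u; rewrite /star /= => ?; exact: filterT.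
Qed.

Lemma star_join (A B : set nat) (u : omega_star) :
  [set: set nat] A -> [set: set nat] B -> star A u -> star B u ->
  exists C, [/\ [set: set nat] C, star C u & star C `<=` star A `&` star B].
Proof.
move=> _ _ uA uB; exists (A `&` B); split=> //.
  by have := omega_star_ultra u; move: uA uB; rewrite /star /= => *; exact: filterI.
move=> v; have := omega_star_ultra v; rewrite /star /= => ? vAB.
by split; move: vAB; apply: filterS => x [].
Qed.

HB.instance Definition _ :=
  isBaseTopological.Build omega_star star_cover star_join.

Section topology.
Context {T : topologicalType}.

Definition boundary (K : set T) : set T := closure K `&` closure (~` K).

Definition P_set (K : set T) : Prop :=
  closed K /\
  forall U : nat -> set T,
    (forall n, set_nbhs K (U n)) -> set_nbhs K (\bigcap_n U n).

Definition nbhs_base (K : set T) (B : set (set T)) : Prop :=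
  B `<=` set_nbhs K /\
  forall U, set_nbhs K U -> exists2 V, B V & V `<=` U.

(** The least cardinality of a neighborhood base of [K] is that of [X]. *)
Definition has_character {W : Type} (K : set T) (X : set W) : Prop :=
  (exists2 B, nbhs_base K B & B #= X) /\
  forall B, nbhs_base K B -> X #<= B.

End topology.

(** [W] is a copy of the ordinal omega_1, up to order isomorphism: it is
    well-ordered and uncountable, with countable initial segments. In
    particular [[set: W]] has cardinality aleph_1. *)
Definition is_omega1 {d : Order.disp_t} (W : orderType d) : Prop :=
  [/\ well_founded (fun a b : W => (a < b)%O),
      forall a : W, countable [set b : W | (b < a)%O] &
      ~ countable [set: W]].

Section omega1_exists.
Let T := set nat.
Let R : rel T := projT1 (wochoice.well_ordering_principle T).
Let woR : wochoice.well_order R := projT2 (wochoice.well_ordering_principle T).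

Let R_refl x : R x x.
Proof.
have [|z [[/= /eqP -> zmin] _]] := woR (A := pred1 x).
  by exists x; rewrite inE.
by apply: zmin; rewrite inE.
Qed.

Let R_total x y : R x y \/ R y x.
Proof.
have [|z [[/pred2P zxy zmin] _]] := woR (A := pred2 x y).
  by exists x; rewrite !inE eqxx.
by case: zxy zmin => -> zmin; [left|right]; apply: zmin; rewrite !inE eqxx ?orbT.
Qed.

Let R_anti : antisymmetric R.
Proof.
move=> x y /andP[xy yx].
have [|z [_ zuniq]] := woR (A := pred2 x y).
  by exists x; rewrite !inE eqxx.
transitivity z; [symmetry|]; apply: zuniq; split; rewrite ?inE ?eqxx ?orbT //;
  by move=> w /pred2P[] ->.
Qed.

Let R_trans : transitive R.
Proof.
move=> y x z xy yz.
have [|w [[win wmin] _]] := woR (A := pred3 x y z).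
  by exists x; rewrite !inE eqxx.
have wx : R w x by apply: wmin; rewrite !inE eqxx.
have wy : R w y by apply: wmin; rewrite !inE eqxx ?orbT.
have wz : R w z by apply: wmin; rewrite !inE eqxx ?orbT.
move: win; rewrite !inE => /or3P[]/eqP e; subst w => //.
- by rewrite -(R_anti (x := x) (y := y)) // in yz *; rewrite ?xy ?wx.
- have := R_anti (x := z) (y := y); rewrite yz wy => /(_ isT) e.
  by rewrite e.
Qed.

Let below (x : T) : set T := [set y | R y x /\ y <> x].

Let W := {x : T | `[< countable (below x) >]}.

Let leW (a b : W) := R (val a) (val b).

Let leW_refl : reflexive leW. Proof. by move=> a; exact: R_refl. Qed.

Let leW_anti : antisymmetric leW.
Proof. by move=> a b ab; apply/val_inj/R_anti. Qed.

Let leW_trans : transitive leW.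
Proof. by move=> b a c; exact: R_trans. Qed.

Let leW_total : total leW.
Proof. by move=> a b; apply/orP; exact: R_total. Qed.

Let WO : Type := W.
HB.instance Definition _ := Choice.on WO.
HB.instance Definition _ :=
  Order.Le_isPOrder.Build (Order.Disp tt tt) WO leW_refl leW_anti leW_trans.
HB.instance Definition _ := Order.POrder_isTotal.Build (Order.Disp tt tt) WO leW_total.

Let ltW_below (a b : WO) : (a < b)%O <-> below (val b) (val a).
Proof.
rewrite lt_neqAle; split=> [/andP[/eqP ab ?]|[? ab]].
  by split=> // /val_inj.
by apply/andP; split=> //; apply/eqP => e; apply: ab; rewrite e.
Qed.

Lemma omega1_exists : exists (d : Order.disp_t) (W : orderType d), is_omega1 W.
Proof.
exists (Order.Disp tt tt), WO; split.
- move=> a; apply: contrapT => na.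
  pose P : pred T := fun x => `[< exists2 b : WO, val b = x &
    ~ Acc (fun a b : WO => (a < b)%O) b >].
  have [|m [[/asboolP[b bm nb] mmin] _]] := woR (A := P).
    by exists (val a); apply/asboolP; exists a.
  apply: nb; constructor => c /ltW_below[cb cNb]; apply: contrapT => nc.
  have bc : R (val b) (val c).
    by rewrite bm; apply: mmin; apply/asboolP; exists c.
  by apply: cNb; apply: R_anti; rewrite cb.
- move=> a; have /asboolP := valP a.
  have e : val @` [set b : WO | (b < a)%O] #= [set b : WO | (b < a)%O].
    by apply: inj_card_eq => b c _ _; exact: val_inj.
  rewrite -(eq_countable e); apply: sub_countable; apply: subset_card_le.
  by move=> _ [b /= /ltW_below ba <-].
- move=> cW.
  pose S : set T := [set x | countable (below x)].
  have cS : countable S.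
    have -> : S = val @` [set: WO].
      apply/seteqP; split=> [x Sx|_ [b _ <-]]; last first.
        by have /asboolP := valP b.
      have Px : `[< countable (below x) >] by apply/asboolP.
      by exists (exist _ x Px).
    exact: sub_countable (card_image_le _ _) cW.
  have [Sx|/existsNP[x nSx]] := pselect (forall x, S x).
    have cT : countable [set: T] by apply: sub_countable cS; apply: subset_card_le => x _; exact: Sx.
    have /countable_injP[g ginj] := cT.
    pose A : T := [set n | exists2 B, g B = n & ~ B n].
    have nA : ~ A (g A).
      by move=> AgA; case: (AgA) => B /ginj ->; rewrite ?inE.
    by apply: (nA); exists A.
  have [|m [[/asboolP nSm mmin] _]] := woR (A := fun x => `[< ~ S x >]).
    by exists x; apply/asboolP.
  apply: nSm; apply: sub_countable cS; apply: subset_card_le => y [ym yNm].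
  apply: contrapT => nSy; apply: yNm; apply: R_anti; rewrite ym.
  by apply: mmin; apply/asboolP.
Qed.
End omega1_exists.

Definition bowtie_of_functions {d : Order.disp_t} {W : orderType d}
    (f : W -> pfun) : Prop :=
  let D := fun a => pdom (f a) in
  [/\ forall a, set_bij (D a) (D a) (f a) /\ (forall x, D a x -> f a x <> x),
      forall a b, (a < b)%O ->
        almost_sub (D a) (D b) /\ infinite_set (D b `\` D a),
      forall a b, (a <= b)%O -> pfun_almost_eq (f a) (prestrict (f b) (D a)) &
      forall A : set nat, exists e : W, forall a, (e <= a)%O ->
        almost_eq (pimage (f a) ((D a `\` D e) `&` A)) ((D a `\` D e) `&` A) /\
        almost_eq (pimage (f a) ((D a `\` D e) `\` A)) ((D a `\` D e) `\` A)].

Definition bowtie_of_involutions {d : Order.disp_t} {W : orderType d}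
    (f : W -> pfun) : Prop :=
  bowtie_of_functions f /\ forall a x, pdom (f a) x -> f a (f a x) = x.

(* Main.v *)
Require Import Defs.
From mathcomp Require Import all_boot all_order.
From mathcomp Require Import all_classical topology.
Import Order.TTheory Order.CTheory.
Local Open Scope classical_set_scope.

(** Extend each [f a] by the identity to a permutation [g a] of omega. For a fixed
    set [A], coherence of the bowtie makes the images of [A `&` D e] under later stages
    agree modulo finite, and clause (iii) makes later stages fix [A `\` D e] modulo
    finite once [e] is large enough. So the class of [g a @` A] is eventually constant
    in [a]; [F] sends the class of [A] to this eventual value. Finitely many sets are
    always evaluated correctly by one late stage, which is a genuine permutation:
    hence [F] is a Boolean automorphism, and an involution if all stages are.

    [F] is not trivial, for two reasons that pull apart: on subsets of [D b] it acts
    as [g b], which has no fixed point in [D b], while it fixes the class of every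
    set [A `\` D e] with [e] large depending on [A]. A function [h] inducing [F] would,
    by the second property applied to one maximal set [A] with [h @` A] disjoint from
    [A] ([maximal_free_set]), have almost no moved point outside [D e], against the
    first property on the infinite set [D b `\` D e].

    On the topological side everything follows from the fact that the neighbourhoods
    of [K] are exactly the sets containing some [star (~` D a)] ([set_nbhs_core]).
    Countable sets of stages are bounded, so [K] is a P-set; every base of [K] gives
    a cofinal set of stages, of cardinality aleph_1 ([card_cofinal]). If
    [star A] avoids the boundary of [K], some [A `\` D a] is almost disjoint from every
    [D b] ([core_bounded]), and then all later stages act on [A] as [g a] does
    ([eventual_image_trivial_on]). *)

(** * Images of sets modulo finite *)

Lemma inj_finite {T U : Type} {A : set T} {f : T -> U} :
  {in A &, injective f} -> finite_set (f @` A) -> finite_set A.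
Proof. by move=> finj; rewrite (eq_finite_set (inj_card_eq finj)). Qed.

Lemma image_almost_eq (g : nat -> nat) (A B : set nat) :
  almost_eq A B -> almost_eq (g @` A) (g @` B).
Proof.
move=> /(finite_image g); apply: sub_finite_set.
move=> _ [[[x Ax <-] nB]|[[x Bx <-] nA]]; exists x => //.
- by left; split=> // Bx; apply: nB; exists x.
- by right; split=> // Ax; apply: nA; exists x.
Qed.

Lemma inj_image_almost_eq (g : nat -> nat) (A B : set nat) : injective g ->
  almost_eq (g @` A) (g @` B) -> almost_eq A B.
Proof.
move=> ginj gAB; apply: (@inj_finite _ _ _ g) => [x y _ _|]; first exact: ginj.
apply: sub_finite_set gAB => _ [x [[Ax nBx]|[Bx nAx]] <-].
- by left; split=> [|[y By /ginj yx]]; [exists x|apply: nBx; rewrite -yx].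
- by right; split=> [|[y Ay /ginj yx]]; [exists x|apply: nAx; rewrite -yx].
Qed.

Lemma image_mod_finite (g h : nat -> nat) (X : set nat) :
  finite_set [set x | X x /\ g x <> h x] -> almost_eq (g @` X) (h @` X).
Proof.
set N := [set x | _] => finN.
apply: (@sub_finite_set _ _ (g @` N `|` h @` N)); last first.
  by rewrite finite_setU; split; apply: finite_image.
move=> _ [[[x Xx <-] nh]|[[x Xx <-] ng]]; [left|right]; exists x => //.
  by split=> // e; apply: nh; exists x.
by split=> // e; apply: ng; exists x.
Qed.

Lemma image_setI_inj {T U : Type} (g : T -> U) (A B : set T) : injective g ->
  g @` (A `&` B) = g @` A `&` g @` B.
Proof.
move=> ginj; apply/seteqP; split=> [|_ [[x Ax <-] [y By /ginj yx]]].
  exact: sub_image_setI.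
by exists x => //; split=> //; rewrite -yx.
Qed.

Lemma image_setC_bij {T U : Type} (g : T -> U) (A : set T) : injective g ->
  (forall y, exists x, g x = y) -> g @` (~` A) = ~` (g @` A).
Proof.
move=> ginj gsurj; apply/seteqP; split=> [_ [x nAx <-] [y Ay /ginj yx]|y ngA].
  by apply: nAx; rewrite -yx.
by have [x gx] := gsurj y; exists x => // Ax; apply: ngA; exists x.
Qed.

(** * Maximal free sets *)

(** In the graph of [k], a maximal independent subset of the moved points dominates
    them. If such a set is negligible and [k] is injective, then almost all of [E]
    is fixed by [k], because the preimage and the image of a finite set are finite;
    this is how the non-triviality argument uses it. *)
Lemma maximal_free_set {T : Type} (E : set T) (k : T -> T) :
  exists A, [/\ A `<=` E, forall x, A x -> ~ A (k x) &
    forall x, E x -> k x <> x -> [\/ A x, A (k x) | exists2 y, A y & k y = x]].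
Proof.
pose P A := A `<=` E /\ forall x, A x -> ~ A (k x).
have [|A [[AE Afree] Amax]] := @Zorn_bigcup T P.
  move=> F FP Ftot; split=> [x [X /FP[XE _] /XE]//|x [X FX Xx] [Y FY Ykx]].
  have [XY|YX] := Ftot _ _ FX FY.
    by have [_ /(_ x)] := FP _ FY; apply=> //; exact: XY.
  by have [_ /(_ x)] := FP _ FX; apply=> //; exact: YX.
(* A point avoiding all three alternatives could be added to A. *)
exists A; split=> // x Ex kx; apply: contrapT => no; apply: (Amax (x |` A)).
  split; first by move=> y; right.
  by move=> /(_ x (or_introl erefl)) Ax; apply: no; apply: Or31.
split=> [y [->//|/AE//]|y [->|Ay] [e|Aky]].
- exact: kx.
- by apply: no; apply: Or32.
- by apply: no; apply: Or33; exists y.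
- exact: (Afree y).
Qed.

(** * Extending a partial permutation by the identity *)

(** Making each member of the bowtie total turns it into a permutation of omega,
    whose action on sets commutes with all Boolean operations on the nose. *)
Definition extend_id (p : pfun) (x : nat) : nat :=
  if `[< pdom p x >] then p x else x.

Lemma extend_id_in {p : pfun} {x} : pdom p x -> extend_id p x = p x.
Proof. by move=> px; rewrite /extend_id asboolT. Qed.

Lemma extend_id_out {p : pfun} {x} : ~ pdom p x -> extend_id p x = x.
Proof. by move=> px; rewrite /extend_id asboolF. Qed.

Lemma extend_id_image_in {p : pfun} {A} :
  A `<=` pdom p -> extend_id p @` A = pimage p A.
Proof.
move=> Ap; apply/seteqP; split=> [_ [x Ax <-]|_ [x [Ax px] <-]].
  by rewrite extend_id_in; [exists x; [split=> //|]|]; try exact: Ap.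
by exists x => //; rewrite extend_id_in.
Qed.

Lemma extend_id_image_out {p : pfun} {A} :
  A `<=` ~` pdom p -> extend_id p @` A = A.
Proof.
move=> Ap; apply/seteqP; split=> [_ [x Ax <-]|x Ax].
  by rewrite extend_id_out //; exact: Ap.
by exists x => //; rewrite extend_id_out //; exact: Ap.
Qed.

Section permutation.
Context (p : pfun) (pP : set_bij (pdom p) (pdom p) p).

Lemma extend_id_dom : extend_id p @` pdom p = pdom p.
Proof.
have [pf _ psurj] := pP; rewrite extend_id_image_in // /pimage setIid.
by apply/seteqP; split=> // _ [x px <-]; exact: pf.
Qed.

Lemma extend_id_inj : injective (extend_id p).
Proof.
have [pf pinj _] := pP => x y.
have [px|px] := pselect (pdom p x); have [py|py] := pselect (pdom p y);
  rewrite ?(extend_id_in px) ?(extend_id_in py) ?(extend_id_out px)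
    ?(extend_id_out py) //.
- exact: pinj (mem_set px) (mem_set py).
- by move=> e; case: py; rewrite -e; exact: pf.
- by move=> e; case: px; rewrite e; exact: pf.
Qed.

Lemma extend_id_surj y : exists x, extend_id p x = y.
Proof.
have [py|py] := pselect (pdom p y); last by exists y; rewrite extend_id_out.
by have : (extend_id p @` pdom p) y; [rewrite extend_id_dom|case=> x _; exists x].
Qed.

End permutation.

(** * Cofinality of omega_1 *)

Section omega1.
Context {d : Order.disp_t} {W : orderType d} (hW : is_omega1 W).

(** A countable unbounded set would cover omega_1 by countably many countable
    initial segments. *)
Lemma countable_bounded (C : set W) :
  countable C -> exists c, forall a, C a -> (a < c)%O.
Proof.
move=> cC; have [_ init_countable W_uncountable] := hW.
apply: contrapT => /forallNP no; apply: W_uncountable.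
have -> : [set: W] = \bigcup_(a in C) ([set b | (b < a)%O] `|` [set a]).
  apply/seteqP; split=> // c _; have /existsNP[a /not_implyP[Ca ca]] := no c.
  exists a => //; move/negP: ca; rewrite -leNgt le_eqVlt => /orP[/eqP ->|?].
    by right.
  by left.
apply: bigcup_countable => // a _; rewrite -bigcup2E.
apply: bigcup_countable => // -[|[|i]] _ /=; first exact: init_countable.
  exact: countable1.
exact: countable0.
Qed.

Lemma omega1_inhabited : exists a : W, True.
Proof.
by have [a _] := countable_bounded set0 (@countable0 W); exists a.
Qed.

Lemma exists_gt (a : W) : exists b, (a < b)%O.
Proof.
have [|b /(_ a erefl) ab] := countable_bounded [set a]; last by exists b.
exact: countable1.
Qed.

(** A cofinal set contains a strictly increasing copy of omega_1, because only
    countably many earlier choices have to be exceeded at each step. *)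
Lemma card_cofinal (S : set W) :
  (forall c, exists2 s, S s & (c < s)%O) -> ([set: W] #<= S)%card.
Proof.
move=> Scof; have [wf init_countable _] := hW.
have /choice[above aboveP] : forall X : set W, exists s,
    S s /\ (countable X -> forall x, X x -> (x < s)%O).
  move=> X; have [cX|nX] := pselect (countable X); last first.
    have [c _] := omega1_inhabited.
    by have [s Ss _] := Scof c; exists s; split.
  have [c cP] := countable_bounded X cX; have [s Ss cs] := Scof c.
  by exists s; split=> // _ x /cP xc; exact: lt_trans cs.
(* phi a is chosen in S above all phi b for b < a. *)
pose step (a : W) (rec : forall b : W, (b < a)%O -> W) :=
  above [set x | exists (b : W) (ba : (b < a)%O), rec b ba = x].
pose phi := Fix wf (fun _ => W) step.
have phiE a : phi a = above (phi @` [set b | (b < a)%O]).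
  rewrite /phi Fix_eq => [|b rec rec' recE].
    congr above; apply/seteqP; split=> [x [b [ba <-]]|_ [b ba <-]].
      by exists b.
    by exists b, ba.
  congr above; apply/seteqP; split=> _ [c [cb <-]]; exists c, cb => //.
have phi_lt a b : (b < a)%O -> (phi b < phi a)%O.
  move=> ba; rewrite [phi a]phiE; have [_] := aboveP (phi @` [set b | (b < a)%O]).
  apply; last by exists b.
  apply: sub_countable (init_countable a); exact: card_image_le.
have phi_inj : injective phi.
  by move=> a b e; case: (ltgtP a b) => // /phi_lt; rewrite e ltxx.
have phiS : phi @` setT `<=` S.
  by move=> _ [a _ <-]; rewrite phiE; have [] := aboveP (phi @` [set b | (b < a)%O]).
apply: card_le_trans (subset_card_le phiS).
by rewrite -(card_le_eql (inj_card_eq (in2W phi_inj))).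
Qed.

End omega1.

(** * The automorphism induced by a bowtie *)

(** The limit of the trivial automorphisms induced by the stages: it is relational
    because the stage from which the images stabilize depends on the set. *)
Definition eventual_image {d : Order.disp_t} {W : orderType d} (f : W -> pfun)
    (F : pow_fin -> pow_fin) : Prop :=
  forall A, exists e, forall b, (e <= b)%O ->
    F (fin_class A) = fin_class (extend_id (f b) @` A).

Section bowtie.
Context {d : Order.disp_t} {W : orderType d}.
Context {f : W -> pfun} (hf : bowtie_of_functions f).

Local Notation D a := (pdom (f a)).
Local Notation g a := (extend_id (f a)).

Let fP a : set_bij (D a) (D a) (f a).
Proof. by have [+ _ _ _] := hf => /(_ a)[]. Qed.

Lemma no_fixed_point a x : D a x -> g a x <> x.
Proof. by move=> ax; rewrite extend_id_in//; have [/(_ a)[_ +] _ _ _] := hf; apply. Qed.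

Lemma dom_almost_sub a b : (a <= b)%O -> almost_sub (D a) (D b).
Proof.
rewrite le_eqVlt => /orP[/eqP ->|ab]; first by rewrite /almost_sub setDv.
by have [_ /(_ _ _ ab)[+ _] _ _] := hf.
Qed.

Lemma disagreement_finite a b : (a <= b)%O ->
  finite_set [set x | D a x /\ g b x <> g a x].
Proof.
move=> ab; have [_ _ /(_ _ _ ab)[/almost_eqP[+ _] /almost_eqP[+ _]] _] := hf.
rewrite /almost_sub /= => finA finB.
have := conj finA finB; rewrite -finite_setU; apply: sub_finite_set.
move=> x [Da ne]; have [Db|nDb] := pselect (D b x); last by left; split=> // -[].
right; split=> // -[_ _ e]; apply: ne.
by rewrite !extend_id_in.
Qed.

Lemma image_below a b X : (a <= b)%O -> X `<=` D a ->
  almost_eq (g b @` X) (g a @` X).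
Proof.
move=> ab Xa; apply: image_mod_finite; apply: sub_finite_set (disagreement_finite _ _ ab).
by move=> x [/Xa].
Qed.

(** This is what clause (iii) of a bowtie says about the total permutations: past
    [D e], every later stage acts on the part of [A] outside [D e] trivially modulo
    finite. Outside [D a] this holds because the permutation is the identity there. *)
Lemma image_above A : exists e, forall a, (e <= a)%O ->
  almost_eq (g a @` (A `\` D e)) (A `\` D e).
Proof.
have [_ _ _ /(_ A)[e eP]] := hf; exists e => a ea.
have [+ _] := eP a ea; set Y := (D a `\` D e) `&` A => YP.
have -> : A `\` D e = Y `|` (A `\` D e) `\` D a.
  apply/seteqP; split=> x; rewrite /Y /setD /setI /setU /=; last by tauto.
  by have := pselect (D a x); tauto.
rewrite image_setU; apply: almost_eqU.
  by rewrite extend_id_image_in => [|x [[]//]].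
by rewrite extend_id_image_out => [|x [_]//]; exact: almost_eq_refl.
Qed.

(** Below [D e] all later stages agree with stage [e] modulo finite by coherence,
    and the hypothesis settles the part of [A] above [D e]; so stabilization of
    the images of [A] is decided above [D e]. *)
Lemma image_stable A e b : (e <= b)%O ->
  almost_eq (g b @` (A `\` D e)) (A `\` D e) -> almost_eq (g b @` A) (g e @` A).
Proof.
move=> eb AP; rewrite -[in g b @` A](setUIDK A (D e)) -[in g e @` A](setUIDK A (D e)).
rewrite !image_setU; apply: almost_eqU; first by apply: image_below => // x [].
by rewrite (@extend_id_image_out (f e)) => [|x []].
Qed.

Lemma eventual_image_exists : exists F, eventual_image f F.
Proof.
have /choice[e eP] : forall A, exists e, forall b, (e <= b)%O ->
    almost_eq (g b @` A) (g e @` A).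
  move=> A; have [e eP] := image_above A; exists e => b eb.
  exact/image_stable/eP.
exists (fun x => fin_class (g (e (repr x)) @` repr x)) => A.
exists (e (repr (fin_class A))) => b eb; apply/fin_classP/almost_eq_sym.
apply: almost_eq_trans (eP _ _ eb).
exact/image_almost_eq/almost_eq_sym/almost_eq_repr.
Qed.

Section eventual_image_theory.
Context {F : pow_fin -> pow_fin} (FP : eventual_image f F).

Lemma eventual_image_below a X : X `<=` D a -> F (fin_class X) = fin_class (g a @` X).
Proof.
move=> Xa; have [e eP] := FP X; pose b := Order.max e a.
rewrite (eP b) ?le_max ?lexx //; apply/fin_classP.
by apply: image_below; rewrite // le_max lexx orbT.
Qed.

Lemma eventual_image_above A : exists e, F (fin_class (A `\` D e)) = fin_class (A `\` D e).
Proof.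
have [e eP] := image_above A; exists e; have [e' e'P] := FP (A `\` D e).
rewrite (e'P (Order.max e e')) ?le_max ?lexx ?orbT //.
by apply/fin_classP/eP; rewrite le_max lexx.
Qed.

Let g_inj a : injective (g a) := extend_id_inj _ (fP a).

Lemma eventual_image_meet : {morph F : x y / (x `&` y)%O}.
Proof.
elim/fin_class_ind=> A; elim/fin_class_ind=> B; rewrite -fin_classI.
have [e1 P1] := FP A; have [e2 P2] := FP B; have [e3 P3] := FP (A `&` B).
pose b := Order.max e1 (Order.max e2 e3).
rewrite (P1 b) ?(P2 b) ?(P3 b) ?le_max ?lexx ?orbT //.
by rewrite -fin_classI image_setI_inj.
Qed.

Lemma eventual_image_compl : {morph F : x / (~` x)%O}.
Proof.
elim/fin_class_ind=> A; rewrite -fin_classC.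
have [e1 P1] := FP A; have [e2 P2] := FP (~` A).
pose b := Order.max e1 e2.
rewrite (P1 b) ?(P2 b) ?le_max ?lexx ?orbT //.
by rewrite image_setC_bij ?fin_classC//; exact: extend_id_surj.
Qed.

Lemma eventual_image_inj : injective F.
Proof.
elim/fin_class_ind=> A; elim/fin_class_ind=> B.
have [e1 P1] := FP A; have [e2 P2] := FP B; pose b := Order.max e1 e2.
rewrite (P1 b) ?(P2 b) ?le_max ?lexx ?orbT // => /fin_classP AB.
exact/fin_classP/(inj_image_almost_eq _ _ _ (@g_inj b)).
Qed.

(** The preimage of [B] under a single stage [e] works, provided [e] is late enough
    for [B]: from then on its images stay almost equal to [B]. *)
Lemma eventual_image_surj y : exists x, F x = y.
Proof.
elim/fin_class_ind: y => B; have [e eP] := image_above B.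
(* Above D e the preimage of B is B itself, so [image_stable] applies to it. *)
exists (fin_class (g e @^-1` B)); have [e' e'P] := FP (g e @^-1` B).
pose b := Order.max e e'.
have eb : (e <= b)%O by rewrite le_max lexx.
rewrite (e'P b) ?le_max ?lexx ?orbT //; apply/fin_classP.
set A := g e @^-1` B; have gA : g e @` A = B.
  apply: image_preimage; apply/seteqP; split=> // y _.
  by have [x] := extend_id_surj _ (fP e) y; exists x.
suff : almost_eq (g b @` A) (g e @` A) by rewrite gA.
apply: image_stable => //; have -> : A `\` D e = B `\` D e; last exact: eP.
by apply/seteqP; split=> x [+ nx]; rewrite /A /= extend_id_out.
Qed.

Lemma eventual_image_automorphism : automorphism F.
Proof.
have [G GF] := choice eventual_image_surj.
split; [|exact: eventual_image_meet| |exact: eventual_image_compl].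
  by exists G => // x; apply: eventual_image_inj.
move=> x y; rewrite -[(x `|` y)%O]complK complU eventual_image_compl eventual_image_meet !eventual_image_compl.
by rewrite complI !complK.
Qed.

(** All the stages are involutions, and [A] and its image are both evaluated
    correctly by a common late stage. *)
Lemma eventual_image_involution : (forall a x, D a x -> f a (f a x) = x) ->
  forall x, F (F x) = x.
Proof.
move=> finv; have ginv a : g a \o g a =1 id.
  move=> x /=; have [ax|nax] := pselect (D a x); last by rewrite !extend_id_out.
  have [ff _ _] := fP a.
  by rewrite [g a x]extend_id_in // extend_id_in ?finv //; exact: ff.
elim/fin_class_ind=> A; have [e P] := FP A.
have [e' P'] := FP (g e @` A); pose b := Order.max e e'.
rewrite (P e) // (P' b) ?le_max ?lexx ?orbT //; apply/fin_classP.
apply: (@almost_eq_trans _ (g b @` (g b @` A))).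
  by apply/image_almost_eq/fin_classP; rewrite -!P // le_max lexx.
by rewrite image_comp (eq_imagel (fun x _ => ginv b x)) image_id; exact: almost_eq_refl.
Qed.

(** Let [h] induce [F], and let [A] be a maximal set that [h] moves off itself. As [F]
    fixes the part of [A] above a late enough [D e], that part is finite; so [h]
    fixes almost every point outside [D e]. But a later stage [b] moves all points
    of the infinite set [D b `\` D e], and [F] acts on the subsets of [D b] as
    stage [b] does. *)
Lemma eventual_image_nontrivial (hW : is_omega1 W) : ~ trivial_automorphism F.
Proof.
move=> [h [B [hfun hinj _] [_ finNh _ _]] hF].
have [A [Ah Afree Amax]] := maximal_free_set (pdom h) h.
have [e FA] := eventual_image_above A; set X := A `\` D e in FA.
(* h moves A off itself while F fixes [X], so X is negligible. *)
have hX_eq Y : F (fin_class Y) = fin_class Y -> almost_eq (pimage h Y) Y.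
  by rewrite hF => /fin_classP.
have finX : finite_set X.
  have /almost_eqP[_] := hX_eq _ FA; apply: sub_finite_set => x Xx.
  split=> // -[y [[Ay _] _] yx]; apply: (Afree y Ay); rewrite yx.
  by case: Xx.
(* Hence A is almost contained in D e; as h almost preserves D e and its
   complement, h moves only finitely many points outside D e. *)
have FD : F (fin_class (D e)) = fin_class (D e).
  by rewrite (eventual_image_below e) // extend_id_dom.
have /almost_eqP[hD _] := hX_eq _ FD.
have /almost_eqP[hND _] : almost_eq (pimage h (~` D e)) (~` D e).
  by apply: hX_eq; rewrite fin_classC eventual_image_compl FD.
have hfin S T : S `<=` pdom h -> finite_set T -> h @` S `<=` T -> finite_set S.
  move=> Sh finT ST; apply: (@inj_finite _ _ _ h); last exact: sub_finite_set finT.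
  by move=> x y /[!inE] /Sh xh /Sh yh; apply: hinj; rewrite inE.
have fin1 : finite_set [set x | [/\ pdom h x, ~ D e x & D e (h x)]].
  apply: hfin hND _ => [x []//|_ [x [hx nx hDx] <-]].
  by split; [exists x|move=> /(_ hDx)].
have fin2 : finite_set [set x | pdom h x /\ X (h x)].
  by apply: hfin finX _ => [x []//|_ [x [] _ ? <-]].
pose M := [set x | [/\ ~ D e x, pdom h x & h x <> x]].
have finM : finite_set M.
  apply: (@sub_finite_set _ _ (X `|` ([set x | [/\ pdom h x, ~ D e x & D e (h x)]]
    `|` ([set x | pdom h x /\ X (h x)] `|` (h @` X `|` (pimage h (D e) `\` D e)))))).
    move=> x [nDx hx hxx]; have [Ax|Ahx|[y Ay yx]] := Amax x hx hxx.
    - by left.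
    - right; have [?|?] := pselect (D e (h x)); first by left.
      by right; left.
    - do 3 right; have [?|?] := pselect (D e y); last by left; exists y.
      by right; split=> //; exists y => //; split=> //; exact: Ah.
  by rewrite !finite_setU; do !split => //; exact: finite_image.
(* On E the automorphism is thus the identity, yet it is induced there by the
   fixed-point free [g b]; so a maximal free set C for [g b] is finite, and E is
   covered by C, its image and its preimage. *)
have [b eb] := exists_gt hW e.
have [_ /(_ _ _ eb)[_ +] _ _] := hf; apply; set E := D b `\` D e.
have [C [CE Cfree Cmax]] := maximal_free_set E (g b).
have CDb : C `<=` D b by move=> x /CE[].
have finC : finite_set C.
  have /fin_classP/almost_eqP[hgC _] : fin_class (pimage h C) = fin_class (g b @` C).
    by rewrite -hF (eventual_image_below b).
  apply: (@sub_finite_set _ _ (M `|` ((setT `\` pdom h) `|` (pimage h C `\` g b @` C)))).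
    move=> x Cx; have [hx|?] := pselect (pdom h x); last by right; left.
    have [hxx|?] := pselect (h x = x); last by left; split=> //; case: (CE x Cx).
    right; right; split; first by exists x.
    by move=> [y Cy yx]; apply: (Cfree y Cy); rewrite yx.
  by rewrite !finite_setU.
apply: (@sub_finite_set _ _ (C `|` (g b @^-1` C `|` g b @` C))).
  move=> x Ex; have bx : D b x by case: Ex.
  have [Cx|Cgx|[y Cy yx]] := Cmax x Ex (no_fixed_point b x bx).
  - by left.
  - by right; left.
  - by right; right; exists y.
rewrite !finite_setU; split=> //; split; last exact: finite_image.
by apply: finite_preimage => // x y _ _; exact: g_inj.
Qed.

(** Later stages differ from stage [a] on [A] only where they grow inside [A], which
    by hypothesis is almost nowhere; so stage [a] alone induces [F] below [A]. *)
Lemma eventual_image_trivial_on A a :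
  (forall b, finite_set (A `&` (D b `\` D a))) -> trivial_on F A.
Proof.
move=> Afin; have FA X : X `<=` A -> F (fin_class X) = fin_class (g a @` X).
  move=> XA; have [e eP] := FP X; pose b := Order.max e a.
  rewrite (eP b) ?le_max ?lexx //; apply/fin_classP.
  apply: image_mod_finite.
  have ab : (a <= b)%O by rewrite le_max lexx orbT.
  apply: (@sub_finite_set _ _ ([set x | D a x /\ g b x <> g a x] `|` (A `&` (D b `\` D a)))).
    move=> x [/XA Ax ne]; have [?|nax] := pselect (D a x); first by left.
    have [?|nbx] := pselect (D b x); first by right.
    by case: ne; rewrite !extend_id_out.
  by rewrite finite_setU; split=> //; exact: disagreement_finite.
exists (g a @` A); split; first exact: FA.
exists (PFun A (g a)) => [|X XA].
  exists (g a @` A) => /=.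
    by split=> [x|x y _ _ /g_inj|y]; [exists x| |].
  by rewrite !setDv; split.
by rewrite FA // /pimage /=; congr fin_class; congr (_ @` _); apply/esym/setIidl.
Qed.

End eventual_image_theory.

End bowtie.

(** * Clopen subsets of omega^* *)

Lemma open_star (A : set nat) : open (star A).
Proof. by exists [set A] => //; rewrite bigcup_set1. Qed.

Lemma nbhs_star (u : omega_star) U :
  nbhs u U <-> exists2 A, ultra_of u A & star A `<=` U.
Proof.
rewrite nbhsE; split=> [[V [[B _ VB] Vu] VU]|[A uA AU]].
  move: Vu; rewrite -VB => -[A BA uA]; exists A => // v vA.
  by apply: VU; rewrite -VB; exists A.
by exists (star A) => //; split=> //; exact: open_star.
Qed.

Lemma star_setC (A : set nat) : star (~` A) = ~` star A.
Proof.
apply/seteqP; split=> u; have uU := omega_star_ultra u; rewrite /star /=.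
  by move=> unA uA; have [x []] := filter_ex (filterI unA uA).
by move=> uA; have [] := in_ultra_setVsetC A uU.
Qed.

Lemma star_mono (X Y : set nat) : X `<=` Y -> star X `<=` star Y.
Proof. by move=> XY u; have uU := omega_star_ultra u; exact: filterS. Qed.

Lemma star_setI (X Y : set nat) : star (X `&` Y) = star X `&` star Y.
Proof.
apply/seteqP; split=> [u uXY|u [uX uY]].
  by split; apply: star_mono uXY => x [].
by have uU := omega_star_ultra u; exact: filterI.
Qed.

Lemma star_setD (X Y : set nat) : star (X `\` Y) = star X `\` star Y.
Proof. by rewrite !setDE star_setI star_setC. Qed.

(** An ultrafilter containing a singleton is principal, so [u] contains the
    complement of each point, hence finite intersections of those. *)
Lemma omega_star_cofinite (u : omega_star) Z : finite_set Z -> ultra_of u (~` Z).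
Proof.
have uU := omega_star_ultra u; move=> finZ.
have -> : ~` Z = \bigcap_(n in Z) ~` [set n].
  apply/seteqP; split=> [x nZx n Zn /= xn|x nZ Zx]; last exact: (nZ x Zx).
  by apply: nZx; rewrite xn.
case/finite_fsetP: finZ => X ->.
apply: filter_bigI => n _; have [un|//] := in_ultra_setVsetC [set n] uU.
case: (@omega_star_nonprincipal u n).
have [_ +] := principal_filter_ultra n; apply=> A nA.
by apply: filterS un => _ ->; exact/principal_filterP.
Qed.

Lemma omega_star_extend (G : set_system nat) : ProperFilter G ->
  (forall Z, finite_set Z -> G (~` Z)) -> exists u : omega_star, G `<=` ultra_of u.
Proof.
move=> GP Gcof; have [H [HU GH]] := ultraFilterLemma GP.
have Hnp n : H <> principal_filter n.
  move=> HE; have : H (~` [set n]) by apply/GH/Gcof/finite_set1.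
  by rewrite HE => /principal_filterP; apply.
by exists (OmegaStar HU Hnp).
Qed.

(** For infinite [Z], the sets that almost contain [Z] form a filter, and any
    ultrafilter extending it is nonprincipal. *)
Lemma star_eq0 (Z : set nat) : star Z = set0 <-> finite_set Z.
Proof.
split=> [Z0|/omega_star_cofinite Zcof]; last first.
  apply/seteqP; split=> // u uZ.
  by have : star (~` Z) u := Zcof u; rewrite star_setC; apply.
apply: contrapT => infZ; pose G : set_system nat := [set S | finite_set (Z `\` S)].
have GF : Filter G.
  split=> [|A B GA GB|A B AB].
  - by rewrite /G /= setDT.
  - by rewrite /G /= setDIr finite_setU.
  - by apply: sub_finite_set; exact: setDS.
have [|S finS|u Gu] := omega_star_extend G.
- by apply: Build_ProperFilter => //; rewrite /G /= setD0.
- by rewrite /G /= setDE setCK; exact: finite_setIr.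
by have : star Z u; [apply: Gu; rewrite /G /= setDv|rewrite Z0].
Qed.

Lemma star_subP (X Y : set nat) : star X `<=` star Y <-> almost_sub X Y.
Proof. by rewrite /almost_sub -star_eq0 star_setD setD_eq0. Qed.

(** * The closed set determined by a bowtie *)

Section omega_star_core.
Context {d : Order.disp_t} {W : orderType d} (hW : is_omega1 W).
Context {f : W -> pfun} (hf : bowtie_of_functions f).

Local Notation D a := (pdom (f a)).
Local Notation K := (\bigcap_(a in [set: W]) star (~` D a)).

Lemma star_domC_sub a b : (a <= b)%O -> star (~` D b) `<=` star (~` D a).
Proof.
move=> ab; apply/star_subP; rewrite /almost_sub setDE setCK setIC -setDE.
exact: (dom_almost_sub hf).
Qed.

Lemma star_domC_sub_le a b : star (~` D b) `<=` star (~` D a) -> (a <= b)%O.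
Proof.
move=> /star_subP; rewrite /almost_sub setDE setCK setIC -setDE => fin.
by rewrite leNgt; apply/negP => ba; have [_ /(_ _ _ ba)[_ +] _ _] := hf; apply.
Qed.

Lemma set_nbhs_star_domC a : set_nbhs K (star (~` D a)).
Proof. by move=> u Ku; apply/nbhs_star; exists (~` D a) => //; exact: Ku. Qed.

(** This is compactness of omega^*, in the form needed: were no [star (~` D a)]
    contained in [U], the filter [G] below would be proper, and an ultrafilter
    extending it would lie in [K] but not in [U]. Every property of [K] rests on this
    description of its neighbourhoods as a decreasing omega_1-sequence. *)
Lemma set_nbhs_core U : set_nbhs K U -> exists a, star (~` D a) `<=` U.
Proof.
move=> KU; apply: contrapT => /forallNP noa.
(* S belongs to G when [star S] contains the part of some [star (~` D a)] that lies
   outside U. *)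
pose G : set_system nat := [set S | exists a, star (~` D a `\` S) `<=` U].
have Gsmall a S : star (~` D a `\` S) = set0 -> G S by move=> e; exists a; rewrite e.
have [a0 _] := omega1_inhabited hW.
have GF : Filter G.
  split=> [|A B [a aA] [b bB]|A B AB [a aA]].
  - by apply: (Gsmall a0); rewrite setDT; exact/star_eq0.
  - exists (Order.max a b) => u; rewrite star_setD star_setI => -[uab nuAB].
    have ua : star (~` D a) u by apply: star_domC_sub uab; rewrite le_max lexx.
    have ub : star (~` D b) u by apply: star_domC_sub uab; rewrite le_max lexx orbT.
    have [uA|nuA] := pselect (star A u); last by apply: aA; rewrite star_setD.
    by apply: bB; rewrite star_setD; split=> // uB; exact: nuAB.
  - by exists a; apply: subset_trans aA; apply: star_mono; exact: setDS.
have [|Z finZ|u Gu] := omega_star_extend G.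
- by apply: Build_ProperFilter => // -[a]; rewrite setD0; exact: noa.
- by apply: (Gsmall a0); rewrite setDE setCK; exact/star_eq0/finite_setIr.
have Ku : K u.
  by move=> a _; apply/Gu/(Gsmall a); rewrite setDv; exact/star_eq0.
have /nbhs_star[B uB BU] := KU u Ku.
have : star (~` B) u.
  apply: Gu; exists a0; apply: subset_trans BU; apply: star_mono.
  by rewrite setDE setCK; exact: subIsetr.
by rewrite star_setC; apply.
Qed.

Lemma core_closed : closed K.
Proof.
apply: closed_bigI => a _; rewrite star_setC; apply: open_closedC; exact: open_star.
Qed.

(** Countably many stages have a common upper bound in omega_1. *)
Lemma core_P_set : P_set K.
Proof.
split=> [|U KU]; first exact: core_closed.
have /choice[a aU] n : exists a, star (~` D a) `<=` U n by exact/set_nbhs_core.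
have [|c ac] := countable_bounded hW (range a).
  exact: sub_countable (card_image_le _ _) (countableP _).
move=> u Ku; apply: filterS (set_nbhs_star_domC c u Ku) => v cv n _.
by apply/aU/(star_domC_sub _ _ _ v cv)/ltW/ac; exists n.
Qed.

(** The sets [star (~` D a)] form a base indexed injectively by omega_1. Conversely,
    picking for each member [V] of a base a stage [a V] with [star (~` D (a V))]
    inside [V] produces cofinally many stages. *)
Lemma core_character : has_character K [set: W].
Proof.
split.
  exists (range (fun a => star (~` D a))).
    split=> [_ [a _ <-]|U /set_nbhs_core[a aU]]; first exact: set_nbhs_star_domC.
    by exists (star (~` D a)) => //; exists a.
  apply: inj_card_eq => a b _ _ ab; apply/le_anti.
  by rewrite !star_domC_sub_le ?ab.
move=> B [BK Bbase]; have [a0 _] := omega1_inhabited hW.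
have /choice[a aP] V : exists a, B V -> star (~` D a) `<=` V.
  have [BV|] := pselect (B V); last by exists a0.
  by have [a] := set_nbhs_core _ (BK V BV); exists a.
apply: card_le_trans (card_image_le a B); apply: card_cofinal => // c.
have [c' cc'] := exists_gt hW c.
have [V BV Vc'] := Bbase _ (set_nbhs_star_domC c').
exists (a V); first by exists V.
by apply: lt_le_trans cc' _; apply: star_domC_sub_le; exact: subset_trans (aP V BV) _.
Qed.

(** As [star A] avoids the boundary of [K], the interior of [K] together with
    [star (~` A)] is a neighbourhood of [K]; a stage [a] witnessing this puts
    [star (A `\` D a)] inside [K], so [A `\` D a] is almost disjoint from every [D b]. *)
Lemma core_bounded A : star A `&` boundary K = set0 ->
  exists a, forall b, finite_set (A `&` (D b `\` D a)).
Proof.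
move=> AK; have [|a aP] := set_nbhs_core (interior K `|` star (~` A)).
  move=> u Ku; have uU := omega_star_ultra u.
  have [uA|unA] := in_ultra_setVsetC A uU; last first.
    by apply/nbhs_star; exists (~` A) => // v; right.
  have : nbhs u (interior K).
    apply: nbhs_interior; apply: contrapT => nKu.
    have : (star A `&` boundary K) u.
      split=> //; split; first exact: subset_closure.
      by rewrite closure_setC.
    by rewrite AK.
  by apply: filterS => v; left.
exists a => b; have : star (A `\` D a) `<=` star (~` D b).
  move=> u uAa; have uU := omega_star_ultra u.
  have uA : star A u by apply: filterS uAa => x [].
  have [Ku|] := aP u (filterS (@subDsetr _ _ _) uAa); last by rewrite star_setC.
  exact: (interior_subset Ku).
move=> /star_subP; rewrite /almost_sub setDE setCK.
by apply: sub_finite_set => x [Ax [bx nax]].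
Qed.

End omega_star_core.

Theorem theorem2p1 (d : Order.disp_t) (W : orderType d) (hW : is_omega1 W)
    (f : W -> pfun) (hf : bowtie_of_functions f) :
  let K := \bigcap_(a in [set: W]) star (~` pdom (f a)) in
  exists F : pow_fin -> pow_fin,
    [/\ automorphism F,
        ~ trivial_automorphism F,
        [/\ closed K, P_set K & has_character K [set: W]],
        forall A : set nat, star A `&` boundary K = set0 -> trivial_on F A &
        bowtie_of_involutions f -> forall x : pow_fin, F (F x) = x].
Proof.
move=> K; have [F FP] := eventual_image_exists hf.
exists F; split.
- exact: (eventual_image_automorphism hf FP).
- exact: (eventual_image_nontrivial hf FP hW).
- by split; [exact: core_closed|exact: core_P_set|exact: core_character].
- move=> A AK; have [a] := core_bounded hW hf A AK.
  exact: (eventual_image_trivial_on hf FP A a).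
- by move=> [_ finv]; exact: (eventual_image_involution hf FP finv).
Qed.
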